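(* Let $\mathcal{E}$ be a complex Hilbert space, let $\varphi:\mathcal{E}\to\mathcal{E}$ satisfy property $\mathcal{P}$, and let $x_1,x_2\in\mathcal{E}$ with $\|x_1\|=\|x_2\|=1$. If $C_\varphi^*$ attains its norm at $\frac{K_{x_1}+K_{x_2}}{\|K_{x_1}+K_{x_2}\|}$, then $\|\varphi(x_1)\|=\|\varphi(x_2)\|$.
   Context: Inner products are linear in the first variable. For a complex Hilbert space $\mathcal{E}$, the Segal-Bargmann space $\mathcal{H}(\mathcal{E})$ is the reproducing kernel Hilbert space of (entire) functions on $\mathcal{E}$ with reproducing kernel $K(z,w)=K_w(z)=\exp\langle z,w\rangle$, $z,w\in\mathcal{E}$; thus $\langle f,K_w\rangle=f(w)$ for $f\in\mathcal{H}(\mathcal{E})$. For a mapping $\varphi:\mathcal{E}\to\mathcal{E}$, the composition operator is $C_\varphi f=f\circ\varphi$. The map $\varphi$ has property $\mathcal{P}$ if: (i) $\varphi(z)=Az+b$ for all $z\in\mathcal{E}$; (ii) $A:\mathcal{E}\to\mathcal{E}$ is a bounded linear operator with $\|A\|\le 1$ and $b\in\mathcal{E}$; (iii) $A^*b$ belongs to the range of $(I-A^*A)^{1/2}$, and $v$ denotes the unique element of $\mathcal{E}$ of smallest norm such that $(I-A^*A)^{1/2}v=A^*b$. Property $\mathcal{P}$ is equivalent to boundedness of $C_\varphi$ on $\mathcal{H}(\mathcal{E})$. A bounded operator $T$ on a Hilbert space attains its norm at a unit vector $x$ if $\|Tx\|=\|T\|$. *)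

(* Defs.v *)
From HB Require Import structures.
From mathcomp Require Import all_boot all_order all_algebra sesquilinear.
From mathcomp Require Import complex.
From mathcomp Require Import all_classical all_reals all_analysis.

Set Implicit Arguments.
Unset Strict Implicit.
Unset Printing Implicit Defensive.

Import Order.TTheory GRing.Theory Num.Theory.
Import numFieldNormedType.Exports.

Local Open Scope classical_set_scope.
Local Open Scope ring_scope.
Local Open Scope complex_scope.

(* A form of type {dot E for Num.conj} is linear in its first argument and
   conjugate-linear in its second one.  The norm of E takes its values in
   R[i], hence so does the last equation. *)
Record hilbertSpace (R : realType) := HilbertSpace {
  hilbert_sort :> completeNormedModType R[i] ;
  hdot : {dot hilbert_sort for Num.conj} ;
  hdot_norm : forall x : hilbert_sort, `|x| ^+ 2 = hdot x x }.

Notation "''[' x , y ]" := (hdot _ x y) : ring_scope.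

Section Operators.
Variable R : realType.

Definition cexp (z : R[i]) : R[i] :=
  (expR (complex.Re z) * cos (complex.Im z))
  +i* (expR (complex.Re z) * sin (complex.Im z)).

(* The real number underlying the norm, which is of the form r%:C. *)
Definition rnorm (E : hilbertSpace R) (x : E) : R := complex.Re `|x|.

(* Extended-real valued: T is bounded iff op_norm T is finite. *)
Definition op_norm (E F : hilbertSpace R) (T : E -> F) : \bar R :=
  ereal_sup [set (rnorm (T x))%:E | x in [set x : E | rnorm x <= 1]].

(* T^* y is the z such that <T x, y> = <x, z> for all x (such a z is unique);
   the default 0 is never used when T is bounded and linear. *)
Definition adjoint (E F : hilbertSpace R) (T : E -> F) (y : F) : E :=
  xget 0 [set z : E | forall x : E, '[T x, y] = '[x, z]].

(* D = B^(1/2).  The inequality lives in R[i], so it says that '[D x, x] is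
   real and nonnegative, and hence that D is self-adjoint. *)
Definition is_sqrt (E : hilbertSpace R) (B : E -> E) (D : {linear E -> E}) :=
  [/\ (op_norm D < +oo)%E,
      forall x : E, 0 <= '[D x, x] &
      forall x : E, D (D x) = B x].

Definition propertyP (E : hilbertSpace R) (phi : E -> E) : Prop :=
  exists (A : {linear E -> E}) (b : E),
    [/\ forall z, phi z = A z + b,
        (op_norm A <= 1)%E &
        exists2 D : {linear E -> E},
          is_sqrt (fun x => x - adjoint A (A x)) D &
          range D (adjoint A b)].

Definition attains_norm_at (E F : hilbertSpace R) (T : E -> F) (x : E) : Prop :=
  rnorm x = 1 /\ (rnorm (T x))%:E = op_norm T.

(* A Hilbert space of functions on X with pointwise operations: f stands for
   the function feval f, and the reproducing kernel is K z w = K_w(z). *)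
Record rkhs (X : Type) (K : X -> X -> R[i]) := RKHS {
  rkhs_sort :> hilbertSpace R ;
  feval : rkhs_sort -> X -> R[i] ;
  fevalD : forall f g x, feval (f + g) x = feval f x + feval g x ;
  fevalZ : forall a f x, feval (a *: f) x = a * feval f x ;
  feval_inj : injective feval ;
  fker : X -> rkhs_sort ;
  fkerE : forall w z, feval (fker w) z = K z w ;
  reproducing : forall f w, '[f, fker w] = feval f w }.

Definition segalBargmann (E : hilbertSpace R) :=
  rkhs (fun z w : E => cexp '[z, w]).

(* C_phi f is the element of H whose underlying function is f \o phi; the
   default 0 is only used when f \o phi does not belong to H, which never
   happens when phi has property P. *)
Definition comp_op (X : Type) (K : X -> X -> R[i]) (H : rkhs K) (phi : X -> X)
    (f : H) : H :=
  xget 0 [set g : H | feval g = feval f \o phi].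

End Operators.

(* Main.v *)
Require Import Defs.
From mathcomp Require Import all_boot all_order all_algebra sesquilinear.
From mathcomp Require Import complex.
From mathcomp Require Import all_classical all_reals all_analysis.
From mathcomp Require Import ring lra.

Set Implicit Arguments.
Unset Strict Implicit.
Unset Printing Implicit Defensive.

Import Order.TTheory GRing.Theory Num.Theory.
Import numFieldNormedType.Exports.

Local Open Scope classical_set_scope.
Local Open Scope ring_scope.
Local Open Scope complex_scope.

(** Write [K_x] for [fker H x], [C] for [comp_op phi], [phi z = A z + b].  Three
    ideas carry the proof.

    The adjoint acts on kernels by [C^* K_x = K_(phi x)].  This needs [f \o phi]
    to belong to the space for every [f], which is the boundedness of [C]
    ([comp_opE]): property P turns the kernel
    [M exp <z, w> - exp <phi z, phi w>] into a product of two positive kernels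
    ([psd_schur]), and a domination between Gram kernels lets one solve
    [<K_x, g> = <K_(phi x), f>] for [g] by a Riesz argument
    ([dominated_solve], [riesz_relation]).

    At a vector where [C^*] attains its norm, the first variation vanishes.
    With [lam] the square of the norm and variations in the directions of the
    kernels [K_z], this says ([maximizer_kernel_eq]), for all [z],
    [exp <phi z, phi x1> + exp <phi z, phi x2>
     = lam (exp <z, x1> + exp <z, x2>)].

    Since [<phi z, phi x> = <z, A^* (phi x)> + <b, phi x>], both sides are
    combinations of exponentials [exp <z, u>], which are free ([exp_free]).
    Unless [x1 = x2], the vectors [u_i = A^* (phi x_i)] are therefore [x1] and
    [x2], in this order or swapped, and [exp <b, phi x_i> = lam] for both [i].
    Finally [|phi x_i|^2 = Re <x_i, u_i> + Re <b, phi x_i>], where neither term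
    depends on [i]: the first is [1] or [Re <x1, x2>], the second [ln lam]. *)

(** * Inner products *)

Section InnerProduct.
Context (R : realType) (E : hilbertSpace R).
Implicit Types (x y z : E) (a : R[i]).

Lemma dotDl x y z : '[x + y, z] = '[x, z] + '[y, z].
Proof. exact: linearDl. Qed.

Lemma dotDr x y z : '[z, x + y] = '[z, x] + '[z, y].
Proof. exact: linearDr. Qed.

Lemma dotZl a x z : '[a *: x, z] = a * '[x, z].
Proof. exact: linearZl_LR. Qed.

Lemma dotZr a x z : '[z, a *: x] = Num.conj a * '[z, x].
Proof. exact: linearZr_LR. Qed.

Lemma dotNl x z : '[- x, z] = - '[x, z].
Proof. exact: linearNl. Qed.

Lemma dotNr x z : '[z, - x] = - '[z, x].
Proof. exact: linearNr. Qed.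

Lemma dot0l z : '[0 : E, z] = 0.
Proof. exact: linear0l. Qed.

Lemma dot0r z : '[z, 0 : E] = 0.
Proof. exact: linear0r. Qed.

Lemma dot_suml (I : Type) (s : seq I) (F : I -> E) z :
  '[\sum_(i <- s) F i, z] = \sum_(i <- s) '[F i, z].
Proof. exact: linear_sumlz. Qed.

Lemma dot_sumr (I : Type) (s : seq I) (F : I -> E) z :
  '[z, \sum_(i <- s) F i] = \sum_(i <- s) '[z, F i].
Proof. exact: linear_sumr. Qed.

Lemma dotC x y : '[x, y] = Num.conj '[y, x].
Proof. by rewrite hermC /= expr0 mul1r. Qed.

Lemma dot_ge0 x : 0 <= '[x, x].
Proof. by rewrite -hdot_norm exprn_ge0. Qed.

Lemma dot_eq0 x : ('[x, x] == 0) = (x == 0).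
Proof. by rewrite -hdot_norm sqrf_eq0 normr_eq0. Qed.

Lemma dot_extl x y : (forall z, '[x, z] = '[y, z]) -> x = y.
Proof.
move=> xy; apply/eqP; rewrite -subr_eq0 -dot_eq0 dotDl dotNl xy subrr.
exact: eqxx.
Qed.

Lemma dot_extr x y : (forall z, '[z, x] = '[z, y]) -> x = y.
Proof. by move=> xy; apply: dot_extl => z; rewrite dotC xy -dotC. Qed.

(** The squared norm as an element of [R], where the order is total. *)
Definition normsq x : R := complex.Re '[x, x].

Lemma dot_normsq x : '[x, x] = (normsq x)%:C.
Proof. by rewrite RRe_real// ger0_real// dot_ge0. Qed.

Lemma normsq_ge0 x : 0 <= normsq x.
Proof. by rewrite -ler0c -dot_normsq dot_ge0. Qed.

Lemma normsq_eq0 x : (normsq x == 0) = (x == 0).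
Proof. by rewrite -dot_eq0 dot_normsq -(inj_eq (@complexI R)). Qed.

Lemma norm_normsq x : `|x| ^+ 2 = (normsq x)%:C.
Proof. by rewrite hdot_norm dot_normsq. Qed.

Lemma ReD (u w : R[i]) : complex.Re (u + w) = complex.Re u + complex.Re w.
Proof. by case: u; case: w. Qed.

Lemma ReN (u : R[i]) : complex.Re (- u) = - complex.Re u.
Proof. by case: u. Qed.

Lemma ReZ (t : R) (u : R[i]) : complex.Re (t%:C * u) = t * complex.Re u.
Proof. by case: u => u v /=; rewrite mul0r subr0. Qed.

Lemma ReC (u : R[i]) : complex.Re (Num.conj u) = complex.Re u.
Proof. by case: u. Qed.

Lemma conj_real (t : R) : Num.conj t%:C = t%:C :> R[i].
Proof. exact: conjc_real. Qed.

Lemma normsqD x y :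
  normsq (x + y) = normsq x + 2 * complex.Re '[x, y] + normsq y.
Proof.
rewrite /normsq dotDl !dotDr !ReD (dotC y x) ReC; ring.
Qed.

Lemma normsqN x : normsq (- x) = normsq x.
Proof. by rewrite /normsq dotNl dotNr opprK. Qed.

Lemma normsqZ (t : R) x : normsq (t%:C *: x) = t ^+ 2 * normsq x.
Proof. by rewrite /normsq dotZl dotZr conj_real !ReZ mulrA expr2. Qed.

Lemma cauchy_schwarz x y : `|'[x, y]| ^+ 2 <= '[x, x] * '[y, y].
Proof.
have [->|y0] := eqVneq y 0.
  by rewrite !dot0r normr0 expr0n /= mulr0.
have yy0 : 0 < '[y, y] by rewrite lt_def dot_eq0 y0 dot_ge0.
(* The squared norm of '[y, y] *: x - '[x, y] *: y is the difference of the
   two sides, times '[y, y]. *)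
have := dot_ge0 ('[y, y] *: x - '[x, y] *: y).
rewrite dotDl !dotDr !dotNl !dotNr !dotZl !dotZr (dot_normsq y) conj_real.
rewrite -(dot_normsq y).
have -> : `|'[x, y]| ^+ 2 = '[x, y] * Num.conj '[x, y] by rewrite normCK.
rewrite -dotC => h.
rewrite -subr_ge0 -(pmulr_rge0 _ yy0); apply: le_trans h _.
rewrite le_eqVlt; apply/orP; left; apply/eqP; ring.
Qed.

End InnerProduct.

(** * Riesz representation for linear relations *)

Section Riesz.
Context (R : realType) (E : hilbertSpace R).
Implicit Types (x y z : E).

Lemma quadratic_ge0 (d a : R) : (forall t, 0 <= t * d + t ^+ 2 * a) -> d = 0.
Proof.
move=> h; have [// | d0] := eqVneq d 0.
have a0 : 0 <= a by have := h 1; have := h (-1); nra.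
have a1 : 0 < a + 1 by lra.
have := h (- d / (a + 1)).
have -> : - d / (a + 1) * d + (- d / (a + 1)) ^+ 2 * a
    = - (d / (a + 1)) ^+ 2 by field; lra.
rewrite oppr_ge0 => le0.
have : (d / (a + 1)) ^+ 2 == 0 by rewrite eq_le le0 sqr_ge0.
by rewrite sqrf_eq0 mulf_eq0 invr_eq0 (gt_eqF a1) orbF (negPf d0).
Qed.

Lemma Re_dot_le x y : 2 * `|complex.Re '[x, y]| <= normsq x + normsq y.
Proof.
have := normsq_ge0 (x + y); have := normsq_ge0 (x - y).
rewrite !normsqD normsqN dotNr ReN => h1 h2.
have : `|complex.Re '[x, y]| <= (normsq x + normsq y) / 2.
  by rewrite ler_norml; apply/andP; split; lra.
by lra.
Qed.

Lemma norm_lt_sqr x (e : R) : 0 < e -> (`|x| < e%:C) = (normsq x < e ^+ 2).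
Proof.
move=> e0; rewrite -ltcR -norm_normsq rmorphXn /=.
by rewrite ltr_pXn2r// nnegrE// ler0c ltW.
Qed.

(** One index at which both quantities are small is the form in which the first
    variation below consumes the convergence of a minimising sequence. *)
Lemma fast_cauchy_cvg (u : nat -> E) :
  (forall n k, normsq (u n - u k) <= 2 * (n.+1%:R^-1 + k.+1%:R^-1)) ->
  exists g, forall e : R, 0 < e ->
    exists n, n.+1%:R^-1 < e /\ normsq (u n - g) < e.
Proof.
move=> hu.
have posC (e : R[i]) : 0 < e -> exists2 r : R, 0 < r & e = r%:C.
  move=> e0; exists (complex.Re e); last by rewrite RRe_real// gtr0_real.
  by rewrite -ltcR RRe_real// gtr0_real.
have small (e : R) : 0 < e -> \forall n \near \oo, n.+1%:R^-1 < e.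
  by move=> e0; exact: (near_infty_natSinv_lt (PosNum e0)).
have cu : cvg (u @ \oo).
  apply: cauchy_cvg; apply: cauchy_exP => e /posC [r r0 ->].
  have d0 : 0 < r ^+ 2 / 4 by rewrite divr_gt0// exprn_gt0.
  have [N _ hN] := small _ d0.
  exists (u N); exists N => // n /= Nn.
  rewrite -ball_normE /ball_ /= norm_lt_sqr//.
  apply: le_lt_trans (hu _ _) _.
  have h1 : _ < _ := hN N (leqnn N); have h2 : _ < _ := hN n Nn.
  rewrite [ltRHS](_ : _ = 2 * (r ^+ 2 / 4 + r ^+ 2 / 4)); last by field.
  by rewrite ltr_pM2l// ltrD.
exists (lim (u @ \oo)) => e e0.
have s0 : 0 < Num.sqrt e by rewrite sqrtr_gt0.
have : \forall n \near \oo, n.+1%:R^-1 < e /\ normsq (u n - lim (u @ \oo)) < e.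
  near=> n; split; first by near: n; exact: small.
  rewrite -(sqr_sqrtr (ltW e0)) -norm_lt_sqr// distrC.
  near: n; apply: cvgr_dist_lt; first exact: cu.
  by rewrite ltcR.
by case=> N _ hN; exists N; apply: (hN N (leqnn N)).
Unshelve. all: by end_near.
Qed.

(** Instead of a functional on a closed subspace, the lemma takes a linear
    relation, which is what a family of prescribed values [<k_i, g> = t_i]
    generates: it need be neither closed nor everywhere defined, and the bound
    alone makes it single-valued.  The vector [g] is the limit of a minimising
    sequence of [|x|^2 - 2 Re t] over the relation, which is Cauchy by the
    parallelogram law; the first variation at the limit gives the equation. *)
Lemma riesz_relation (P : E -> R[i] -> Prop) (M : R) :
  P 0 0 ->
  (forall x y t s, P x t -> P y s -> P (x + y) (t + s)) ->
  (forall a x t, P x t -> P (a *: x) (a * t)) ->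
  (forall x t, P x t -> `|t| ^+ 2 <= M%:C * '[x, x]) ->
  exists g, forall x t, P x t -> '[x, g] = t.
Proof.
move=> P0 PD PZ PM.
have Mpos : exists2 M' : R, 0 < M' &
    forall x t, P x t -> complex.Re t ^+ 2 <= M' * normsq x.
  exists (`|M| + 1) => [|x t Pxt]; first by rewrite ltr_wpDl.
  have := PM _ _ Pxt; rewrite dot_normsq -add_Re2_Im2 -rmorphM /= lecR => h.
  have := normsq_ge0 x; have := sqr_ge0 (complex.Im t); have := ler_norm M.
  by nra.
have {Mpos} [M' M'0 PM'] := Mpos.
pose J x (t : R[i]) := normsq x - 2 * complex.Re t.
pose S : set R := [set r | exists x t, P x t /\ r = J x t].
have infS : has_inf S.
  split; first by exists (J 0 0); exists 0, 0.
  (* Completing the square, [M' * J x t >= (Re t - M')^2 - M'^2]. *)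
  exists (- M') => _ [x [t [/PM' Pxt ->]]]; rewrite /J.
  have : 0 <= M' * (normsq x - 2 * complex.Re t + M').
    have := sqr_ge0 (complex.Re t - M'); nra.
  by rewrite pmulr_rge0// => ?; lra.
pose m := inf S.
have Jm x t : P x t -> m <= J x t.
  by move=> Pxt; apply: ge_inf; [exact: infS.2|exists x, t].
have /choice [u hu] : forall n : nat, exists p : E * R[i],
    P p.1 p.2 /\ J p.1 p.2 < m + n.+1%:R^-1.
  move=> n; have n0 : 0 < n.+1%:R^-1 :> R by rewrite invr_gt0.
  by have [_ [x [t [Pxt ->]]] h] := inf_adherent n0 infS; exists (x, t).
have [g hg] : exists g, forall e : R, 0 < e ->
    exists n, n.+1%:R^-1 < e /\ normsq ((u n).1 - g) < e.
  apply: fast_cauchy_cvg => n k.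
  have [Pn Jn] := hu n; have [Pk Jk] := hu k.
  have := Jm _ _ (PZ (2^-1)%:C _ _ (PD _ _ _ _ Pn Pk)).
  rewrite /J in Jn Jk *.
  rewrite normsqZ ReZ ReD !normsqD normsqN dotNr ReN => h.
  have e2 : (2^-1 : R) ^+ 2 = 1 / 4 by field.
  rewrite e2 in h; move: (n.+1%:R^-1) (k.+1%:R^-1) Jn Jk => i j Jn Jk; lra.
have gRe x t : P x t -> complex.Re '[x, g] = complex.Re t.
  move=> Pxt; apply/eqP; rewrite -subr_eq0; apply/eqP.
  apply: (@quadratic_ge0 _ (normsq x)) => r.
  rewrite leNgt; apply/negP => neg.
  pose e := - (r * (complex.Re '[x, g] - complex.Re t) + r ^+ 2 * normsq x).
  have e0 : 0 < e by rewrite oppr_gt0.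
  have [n [ne gne]] := hg _ e0; have [Pn Jn] := hu n.
  have := Jm _ _ (PD _ _ _ _ Pn (PZ r%:C _ _ Pxt)).
  (* Replacing [(u n).1] by [g] in the variation costs at most
     [r^2 |x|^2 + |(u n).1 - g|^2], hence the doubled quadratic term. *)
  have := Re_dot_le (r%:C *: x) ((u n).1 - g).
  rewrite /J in Jn *.
  rewrite (normsqD (u n).1 (_ *: _)) normsqZ ReD !ReZ.
  rewrite (dotC (u n).1 (_ *: _)) ReC !dotZl dotDr dotNr !ReZ ReD ReN.
  have := ler_norm (r * (complex.Re '[x, (u n).1] - complex.Re '[x, g])).
  move: (n.+1%:R^-1) Jn ne => i Jn ne.
  have : e = - (r * (complex.Re '[x, g] - complex.Re t)
    + r ^+ 2 * normsq x) by [].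
  by lra.
exists g => x t Pxt.
have := gRe _ _ (PZ 'i _ _ Pxt); rewrite dotZl.
rewrite (mulrC 'i%C '[_, _]) (mulrC 'i%C t) !ReiNIm.
move: (gRe _ _ Pxt).
by case: '[x, g] => a b; case: t {Pxt} => c d /= -> /oppr_inj ->.
Qed.

End Riesz.

(** * Operator norms, adjoints and property P *)

Section Operators.
Context (R : realType).
Implicit Types E F : hilbertSpace R.

Lemma norm_rnorm E (x : E) : `|x| = (rnorm x)%:C.
Proof. by rewrite /rnorm RRe_real// normr_real. Qed.

Lemma rnorm_ge0 E (x : E) : 0 <= rnorm x.
Proof. by rewrite -ler0c -norm_rnorm. Qed.

Lemma rnorm_sqr E (x : E) : rnorm x ^+ 2 = normsq x.
Proof. by apply: complexI; rewrite rmorphXn /= -norm_rnorm norm_normsq. Qed.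

Lemma rnormZ E a (x : E) : rnorm (a *: x) = complex.Re `|a| * rnorm x.
Proof.
rewrite /rnorm normrZ (norm_rnorm x) -(RRe_real (normr_real a)).
by rewrite -rmorphM.
Qed.

Lemma adjointE E F (T : E -> F) y z :
  (forall x, '[T x, y] = '[x, z]) -> adjoint T y = z.
Proof.
move=> Tz; rewrite /adjoint; apply: xget_unique => //= z' Tz'.
by apply: dot_extr => x; rewrite -Tz' Tz.
Qed.

Lemma op_norm_ge E F (T : E -> F) x :
  rnorm x <= 1 -> ((rnorm (T x))%:E <= op_norm T)%E.
Proof. by move=> x1; apply: ereal_sup_ubound; exists x. Qed.

(** Homogeneity is asked only along the line of [x]: the adjoint of an operator,
    being defined by a choice, is known to be homogeneous only where it has been
    computed. *)
Lemma op_norm_homogeneous E F (T : E -> F) (L : R) x :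
  (op_norm T <= L%:E)%E -> (forall a, T (a *: x) = a *: T x) ->
  normsq (T x) <= L ^+ 2 * normsq x.
Proof.
move=> TL Tx.
have L0 : 0 <= L.
  rewrite -lee_fin (le_trans _ TL)// (le_trans _ (op_norm_ge _ (x := 0) _))//.
    by rewrite lee_fin rnorm_ge0.
  by rewrite /rnorm normr0.
have scaled (t : R) : 0 <= t -> t * rnorm x <= 1 -> t * rnorm (T x) <= L.
  have nt (G : hilbertSpace R) (y : G) :
      0 <= t -> rnorm (t%:C *: y) = t * rnorm y.
    by move=> t0; rewrite rnormZ ger0_norm ?ler0c.
  move=> t0; rewrite -!nt// -Tx => tx.
  by rewrite -lee_fin (le_trans _ TL)// op_norm_ge.
rewrite -!rnorm_sqr -exprMn ler_pXn2r ?nnegrE ?mulr_ge0 ?rnorm_ge0//.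
have [x0|x0] := eqVneq (rnorm x) 0.
  (* Every multiple of [x] lies in the unit ball, so the multiples of [T x]
     are bounded. *)
  rewrite x0 mulr0 leNgt; apply/negP => Tx0.
  have := scaled ((L + 1) / rnorm (T x)).
  rewrite x0 mulr0 divrK ?unitfE ?gt_eqF// divr_ge0 ?addr_ge0 ?rnorm_ge0//.
  by move=> /(_ isT ler01); lra.
have := scaled (rnorm x)^-1; rewrite invr_ge0 rnorm_ge0 mulVf// lexx.
by move=> /(_ isT isT); rewrite ler_pdivrMl 1?mulrC// lt_def x0 rnorm_ge0.
Qed.

Lemma adjointP E (A : {linear E -> E}) :
  (forall x, normsq (A x) <= normsq x) ->
  forall x y, '[A x, y] = '[x, adjoint A y].
Proof.
move=> A1 x y.
have [|u v s t -> ->|a u s ->|u s ->|g hg] :=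
    @riesz_relation R E (fun u s => s = '[A u, y]) (normsq y).
- by rewrite linear0 dot0l.
- by rewrite linearD dotDl.
- by rewrite linearZ dotZl.
- apply: le_trans (cauchy_schwarz _ _) _.
  rewrite !dot_normsq -!rmorphM /= lecR mulrC.
  by rewrite ler_wpM2l ?normsq_ge0.
by rewrite (@adjointE _ _ A y g) => [|u]; rewrite (hg _ _ erefl).
Qed.

(** Positivity alone makes [D] self-adjoint over the complex field: the
    quadratic form being real at [x + y] and at [x + 'i y] determines the
    imaginary and the real part of the sesquilinear form. *)
Lemma pos_selfadjoint E (D : {linear E -> E}) :
  (forall x, 0 <= '[D x, x]) -> forall x y, '[D x, y] = '[x, D y].
Proof.
move=> D0 x y; rewrite (dotC x (D y)).
have hx := ger0_Im (D0 x); have hy := ger0_Im (D0 y).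
have := ger0_Im (D0 (x + y)); have := ger0_Im (D0 (x + 'i *: y)).
have := ger0_Im (D0 ('i *: y)).
rewrite !(linearD D) (linearZ_LR D) /= !dotDl !dotDr !dotZl !dotZr.
move: hx hy.
case: '[D x, x] => ? ?; case: '[D y, y] => ? ?.
case: '[D x, y] => a b; case: '[D y, x] => c d.
simpc => /= hx hy h1 h2 h3; rewrite [RHS](_ : _ = c -i* d)//.
apply/eqP; rewrite eq_complex /=; apply/andP; split; apply/eqP; lra.
Qed.

(** All that the kernel computations retain of property P: [D] is the square
    root of [I - A^* A], so [<D z, D w> = <z, w> - <A z, A w>], and
    [D v = A^* b]. *)
Lemma propertyP_split E (phi : E -> E) : propertyP phi ->
  exists (A D : E -> E) (b v : E),
  [/\ forall z, phi z = A z + b,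
      forall x y, '[A x, y] = '[x, adjoint A y],
      forall z w, '[z, w] = '[A z, A w] + '[D z, D w] &
      forall z, '[A z, b] = '[D z, v]].
Proof.
move=> [A [b [phiE A1 [D [_ D0 DD] [v _ Dv]]]]].
have AP : forall x y, '[A x, y] = '[x, adjoint A y].
  apply: adjointP => x; rewrite -[leRHS]mul1r -(expr1n _ 2).
  by apply: op_norm_homogeneous => // a; rewrite linearZ.
exists A, D, b, v; split => // [z w|z].
  by rewrite (pos_selfadjoint D0) DD dotDr dotNr -AP addrC subrK.
by rewrite (pos_selfadjoint D0) Dv AP.
Qed.

End Operators.

(** * Positive semidefinite kernels *)

Section Kernels.
Context (R : realType) (X : Type).
Implicit Types (B : X -> X -> R[i]) (s : seq (R[i] * X)) (V W : hilbertSpace R).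

Definition lincomb V (k : X -> V) s : V := \sum_(p <- s) p.1 *: k p.2.

Lemma lincomb_cat V (k : X -> V) s1 s2 :
  lincomb k (s1 ++ s2) = lincomb k s1 + lincomb k s2.
Proof. by rewrite /lincomb big_cat. Qed.

Lemma lincomb_scale V (k : X -> V) a s :
  lincomb k [seq (a * p.1, p.2) | p <- s] = a *: lincomb k s.
Proof.
rewrite /lincomb big_map scaler_sumr.
by apply: eq_bigr => p _; rewrite scalerA.
Qed.

Definition kform B s : R[i] :=
  \sum_(p <- s) \sum_(q <- s) p.1 * Num.conj q.1 * B p.2 q.2.

Definition psd_kernel B := forall s, 0 <= kform B s.

Lemma kformD B1 B2 s :
  kform (fun x y => B1 x y + B2 x y) s = kform B1 s + kform B2 s.
Proof.
rewrite /kform -big_split; apply: eq_bigr => p _.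
by rewrite -big_split; apply: eq_bigr => q _; rewrite mulrDr.
Qed.

Lemma kformZ a B s : kform (fun x y => a * B x y) s = a * kform B s.
Proof.
rewrite /kform mulr_sumr; apply: eq_bigr => p _.
by rewrite mulr_sumr; apply: eq_bigr => q _; rewrite mulrCA.
Qed.

Lemma kform_rescale (a : X -> R[i]) B s :
  kform (fun x y => a x * Num.conj (a y) * B x y) s =
  kform B [seq (p.1 * a p.2, p.2) | p <- s].
Proof.
rewrite /kform big_map; apply: eq_bigr => p _.
rewrite big_map; apply: eq_bigr => q _ /=.
by rewrite rmorphM /=; ring.
Qed.

Lemma kform_gram V (k : X -> V) s :
  kform (fun x y => '[k x, k y]) s = '[lincomb k s, lincomb k s].
Proof.
rewrite /kform /lincomb dot_suml; apply: eq_bigr => p _.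
rewrite dot_sumr; apply: eq_bigr => q _.
by rewrite dotZl dotZr mulrA.
Qed.

Lemma kform_rank1 V (k : X -> V) e s :
  kform (fun x y => '[k x, e] * '[e, k y]) s =
  '[lincomb k s, e] * '[e, lincomb k s].
Proof.
rewrite /kform /lincomb dot_suml dot_sumr mulr_suml.
apply: eq_bigr => p _; rewrite mulr_sumr; apply: eq_bigr => q _.
by rewrite dotZl dotZr; ring.
Qed.

Lemma psd_cauchy_schwarz V (k : X -> V) e :
  psd_kernel (fun x y => '[e, e] * '[k x, k y] + -1 * ('[k x, e] * '[e, k y])).
Proof.
move=> s; rewrite kformD !kformZ kform_gram kform_rank1 mulN1r subr_ge0.
have := cauchy_schwarz (lincomb k s) e.
by rewrite normCK -dotC [X in _ <= X -> _]mulrC.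
Qed.

(** A domination [h^* h <= M k^* k] of Gram kernels says that sending [k x] to
    [h x] extends to a bounded operator on the span; the solution [g] is the
    image of [f] under the adjoint of that operator. *)
Lemma dominated_solve V W (k : X -> V) (h : X -> W) (M : R) :
  psd_kernel (fun x y => M%:C * '[k x, k y] + -1 * '[h x, h y]) ->
  forall f, exists g, forall x, '[k x, g] = '[h x, f].
Proof.
move=> hkh f.
pose P v t := exists s, v = lincomb k s /\ t = '[lincomb h s, f].
have [|_ _ _ _ [s [-> ->]] [s' [-> ->]]|a _ _ [s [-> ->]]|_ _ [s [-> ->]]|g hg]
    := @riesz_relation R V P (M * normsq f).
- by exists [::]; rewrite /lincomb !big_nil dot0l.
- by exists (s ++ s'); rewrite !lincomb_cat dotDl.
- by exists [seq (a * p.1, p.2) | p <- s]; rewrite !lincomb_scale dotZl.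
- apply: le_trans (cauchy_schwarz _ _) _.
  have := hkh s; rewrite kformD !kformZ !kform_gram mulN1r subr_ge0 => hs.
  rewrite (dot_normsq f) [X in X <= _]mulrC rmorphM /= [X in _ <= X]mulrAC.
  by rewrite mulrC ler_wpM2r// ler0c normsq_ge0.
exists g => x; apply: hg; exists [:: (1, x)].
by rewrite /lincomb !big_seq1 !scale1r.
Qed.

End Kernels.

(** Schur product theorem, one factor being given as a Gram kernel.  Removing
    from all the [g y] their component along one [g x] splits off a kernel
    [a x * conj (a y)], with which the product is a mere rescaling; this leaves
    vectors supported on fewer points. *)
Lemma psd_schur (R : realType) (X : eqType) (V : hilbertSpace R)
    (B : X -> X -> R[i]) (g : X -> V) :
  psd_kernel B -> psd_kernel (fun x y => B x y * '[g x, g y]).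
Proof.
move=> B0 s.
suff fin_supp (t : seq X) : forall g : X -> V,
    (forall x, x \notin t -> g x = 0) ->
    0 <= kform (fun x y => B x y * '[g x, g y]) s.
  pose t := [seq p.2 | p <- s].
  have := fin_supp t (fun x => if x \in t then g x else 0).
  move=> /(_ (fun x h => ifN _ _ h)).
  congr (0 <= _); rewrite /kform; apply: eq_big_seq => p ps.
  apply: eq_big_seq => q qs.
  by rewrite !(map_f snd).
elim: t => [|e t IH] {}g g0.
  rewrite /kform big1// => p _; rewrite big1// => q _.
  by rewrite g0// dot0l !mulr0.
have [ge0|gN0] := eqVneq (g e) 0.
  apply: IH => x xt; have [->//|xe] := eqVneq x e.
  by apply: g0; rewrite inE negb_or xe.
have nN0 : '[g e, g e] != 0 by rewrite dot_eq0.
pose a x := '[g x, g e] / '[g e, g e].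
pose g' x := g x - a x *: g e.
have split x y : '[g x, g y]
    = '[g' x, g' y] + '[g e, g e] * (a x * Num.conj (a y)).
  have ca : Num.conj (a y) = '[g e, g y] / '[g e, g e].
    by rewrite /a rmorphM fmorphV /= -!dotC.
  rewrite /g' !dotDl !dotDr !dotNl !dotNr !dotZl !dotZr ca /a.
  by field.
have -> : kform (fun x y => B x y * '[g x, g y]) s =
    kform (fun x y => B x y * '[g' x, g' y]) s +
    '[g e, g e] * kform (fun x y => a x * Num.conj (a y) * B x y) s.
  rewrite -kformZ -kformD; congr kform.
  by apply/funext => x; apply/funext => y; rewrite split; ring.
rewrite addr_ge0 ?mulr_ge0 ?dot_ge0 ?kform_rescale//.
apply: IH => x xt; rewrite /g'; have [->|xe] := eqVneq x e.
  by rewrite /a divff// scale1r subrr.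
by rewrite /a g0 ?inE ?negb_or ?xe// dot0l mul0r scale0r subrr.
Qed.

(** * Complex exponentials *)

Section ComplexExponential.
Context (R : realType).
Implicit Types z w : R[i].

Lemma cexpD z w : cexp (z + w) = cexp z * cexp w.
Proof.
case: z w => a b [c d]; rewrite /cexp /= expRD cosD sinD.
by apply/eqP; rewrite eq_complex /=; apply/andP; split; apply/eqP; ring.
Qed.

Lemma cexp_real (t : R) : cexp t%:C = (expR t)%:C.
Proof. by rewrite /cexp /= cos0 sin0 mulr1 mulr0. Qed.

Lemma normsq_cexp z :
  complex.Re (cexp z) ^+ 2 + complex.Im (cexp z) ^+ 2 =
  expR (complex.Re z) ^+ 2.
Proof. by rewrite /cexp /= !exprMn -mulrDr cos2Dsin2 mulr1. Qed.

Lemma cexp_neq0 z : cexp z != 0.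
Proof.
apply/eqP => z0; have := normsq_cexp z; rewrite z0 /= expr0n /= addr0 => /eqP.
by rewrite eq_sym sqrf_eq0 gt_eqF// expR_gt0.
Qed.

Lemma Re_cexp_inj z w : cexp z = cexp w -> complex.Re z = complex.Re w.
Proof.
move=> zw; apply: expR_inj; apply/eqP.
by rewrite -(@eqrXn2 _ 2) ?expR_ge0// -!normsq_cexp zw.
Qed.

(** Translating the variable by [h] multiplies the coefficient of [u] by
    [exp <h, u>]; subtracting [exp <h, u0>] times the original relation
    eliminates the exponent [u0], and [h] can be chosen so that no given other
    coefficient is lost. *)
Lemma exp_free (E : hilbertSpace R) (s : seq E) (c : E -> R[i]) :
  uniq s -> (forall z : E, \sum_(u <- s) c u * cexp '[z, u] = 0) ->
  forall u, u \in s -> c u = 0.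
Proof.
elim: s c => // u0 s IH c /= /andP[u0s us] c0.
have cs u : u \in s -> c u = 0.
  move=> uins.
  have uu0 : u - u0 != 0 by rewrite subr_eq0; apply: contraNneq u0s => <-.
  pose h := (normsq (u - u0))^-1%:C *: (u - u0).
  have hu : '[h, u] = '[h, u0] + 1.
    rewrite -{1}(subrK u0 u) dotDr addrC; congr (_ + _).
    rewrite dotZl dot_normsq -rmorphM /=.
    by rewrite mulVf// normsq_eq0.
  have translate (z : E) : \sum_(w <- s)
      c w * (cexp '[h, w] - cexp '[h, u0]) * cexp '[z, w] = 0.
    transitivity (\sum_(w <- u0 :: s) c w * cexp '[h + z, w] -
        cexp '[h, u0] * \sum_(w <- u0 :: s) c w * cexp '[z, w]).
      rewrite mulr_sumr -sumrB big_cons dotDl cexpD.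
      rewrite [X in _ = X + _](_ : _ = 0) ?add0r; last by ring.
      by apply: eq_bigr => w _; rewrite dotDl cexpD; ring.
    by rewrite !c0 mulr0 subrr.
  have /eqP := IH _ us translate _ uins; rewrite hu.
  rewrite mulf_eq0 => /orP[/eqP //|].
  rewrite subr_eq0 => /eqP /Re_cexp_inj; rewrite ReD /= => /eqP.
  by rewrite -subr_eq0 addrC addKr oner_eq0.
move=> u; rewrite inE => /orP[/eqP ->|]; last exact: cs.
have := c0 0; rewrite big_cons big1_seq ?addr0 => [/eqP|v /= vs].
  by rewrite mulf_eq0 (negPf (cexp_neq0 _)) orbF => /eqP.
by rewrite cs// mul0r.
Qed.

End ComplexExponential.

(** * Boundedness of the composition operator *)

Section SegalBargmann.
Context (R : realType) (E : hilbertSpace R) (H : segalBargmann E).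
Implicit Types (f g : H) (x y z : E).

Lemma dot_fker x y : '[fker H x, fker H y] = cexp '[y, x].
Proof. by rewrite reproducing fkerE. Qed.

(** Property P makes [C_phi] bounded.  By [<z, w> = <A z, A w> + <D z, D w>]
    and [<A z, b> = <D z, v>], the kernel
    [e^(|b|^2 + |v|^2) K(y, x) - K(phi y, phi x)] is [e^(|b|^2)] times
    [exp <A y, A x>] times
    [|K_v|^2 K(D y, D x) - K_v(D y) conj (K_v(D x))],
    whose last factor is positive by the Cauchy-Schwarz inequality; the
    Schur product theorem and domination of kernels then apply. *)
Lemma comp_opE (phi : E -> E) : propertyP phi ->
  forall f x, feval (comp_op phi f) x = feval f (phi x).
Proof.
move=> /propertyP_split [A [D [b [v [phiE AP AD Ab]]]]] f.
suff [g hg] : exists g, forall x, '[fker H x, g] = '[fker H (phi x), f].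
  suff h : feval (comp_op phi f) = feval f \o phi by move=> x; rewrite h.
  rewrite /comp_op; apply: (@xgetPex _ 0 [set g | feval g = feval f \o phi]).
  exists g => /=; apply/funext => x /=.
  by rewrite -!reproducing dotC hg -dotC.
have bR : cexp '[b, b] = (expR (normsq b))%:C by rewrite dot_normsq cexp_real.
have vR : cexp '[v, v] = (expR (normsq v))%:C by rewrite dot_normsq cexp_real.
apply: (@dominated_solve _ _ _ _ _ _ (expR (normsq b) * expR (normsq v))).
have := @psd_schur _ _ _ _ (fun x => fker H (A x))
  (fun s => psd_cauchy_schwarz (fun x => fker H (D x)) (fker H v) s).
move=> psdS s; have := mulr_ge0 _ (psdS s) => /(_ (cexp '[b, b])).
rewrite -kformZ bR ler0c expR_ge0 => /(_ isT).
congr (0 <= kform _ s); apply/funext => x; apply/funext => y.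
rewrite !dot_fker vR (AD y x) !phiE !dotDl !dotDr !cexpD Ab.
by rewrite (dotC b (A x)) Ab -dotC bR rmorphM /=; ring.
Qed.

Lemma adjoint_comp_op (phi : E -> E) : propertyP phi -> forall s,
  adjoint (comp_op (H := H) phi) (lincomb (fker H) s) =
  lincomb (fker H \o phi) s.
Proof.
move=> hphi s; apply: adjointE => f; rewrite /lincomb !dot_sumr.
apply: eq_bigr => p _; rewrite !dotZr /= !reproducing.
by rewrite comp_opE.
Qed.

End SegalBargmann.

(** * Norm-attaining vectors *)

(** The difference [lam |x|^2 - |y|^2] is a nonnegative quadratic form on the
    relation, so its polar form vanishes against any point where it vanishes.
    For [y = T x] this is the eigenvalue equation [T^* T x0 = lam x0] at a
    maximising vector, tested only against the domain of the relation. *)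
Lemma maximizer_polar (R : realType) (V W : hilbertSpace R) (P : V -> W -> Prop)
    (lam : R) (x0 : V) (y0 : W) :
  (forall x y x' y', P x y -> P x' y' -> P (x + x') (y + y')) ->
  (forall a x y, P x y -> P (a *: x) (a *: y)) ->
  (forall x y, P x y -> normsq y <= lam * normsq x) ->
  P x0 y0 -> normsq y0 = lam * normsq x0 ->
  forall x y, P x y -> '[y0, y] = lam%:C * '[x0, x].
Proof.
move=> PD PZ Ple P0 eq0.
have ReE x y : P x y -> complex.Re '[y0, y] = lam * complex.Re '[x0, x].
  move=> Pxy; apply/eqP; rewrite eq_sym -subr_eq0; apply/eqP.
  have h : 2 * (lam * complex.Re '[x0, x] - complex.Re '[y0, y]) = 0.
    apply: (@quadratic_ge0 _ _ (lam * normsq x - normsq y)) => t.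
    have := Ple _ _ (PD _ _ _ _ P0 (PZ t%:C _ _ Pxy)).
    by rewrite !normsqD !normsqZ !dotZr !conj_real !ReZ eq0; nra.
  by lra.
move=> x y Pxy; have := ReE _ _ (PZ 'i _ _ Pxy); move: (ReE _ _ Pxy).
rewrite !dotZr; case: '[y0, y] => a b; case: '[x0, x] => c d /=.
rewrite !mul0r !mulN1r !opprK !add0r => -> ->.
by apply/eqP; rewrite eq_complex /= !mul0r subr0 addr0 !eqxx.
Qed.

Section NormAttaining.
Context (R : realType) (E : hilbertSpace R) (H : segalBargmann E).
Context (phi : E -> E) (hphi : propertyP phi).

Lemma maximizer_kernel_eq x1 x2 :
  attains_norm_at (adjoint (comp_op (H := H) phi))
    (`|fker H x1 + fker H x2|^-1 *: (fker H x1 + fker H x2)) ->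
  exists2 lam : R, 0 < lam & forall z,
    cexp '[phi z, phi x1] + cexp '[phi z, phi x2] =
    lam%:C * (cexp '[z, x1] + cexp '[z, x2]).
Proof.
set T := adjoint _; set a := _^-1 => -[n1 nT].
pose k := fker H; pose h : E -> H := fker H \o phi.
have kE x : k x = lincomb k [:: (1, x)] by rewrite /lincomb big_seq1 scale1r.
have hE x : h x = lincomb h [:: (1, x)] by rewrite /lincomb big_seq1 scale1r.
pose P u w := exists s, u = lincomb k s /\ w = lincomb h s.
have PD x y x' y' : P x y -> P x' y' -> P (x + x') (y + y').
  move=> [s [-> ->]] [s' [-> ->]]; exists (s ++ s').
  by rewrite !lincomb_cat.
have PZ b x y : P x y -> P (b *: x) (b *: y).
  move=> [s [-> ->]]; exists [seq (b * p.1, p.2) | p <- s].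
  by rewrite !lincomb_scale.
have Pkh x : P (k x) (h x) by exists [:: (1, x)]; rewrite -kE -hE.
have PT x y : P x y -> T x = y.
  by move=> [s [-> ->]]; rewrite /T adjoint_comp_op.
have P0 : P (a *: (k x1 + k x2)) (a *: (h x1 + h x2)) by apply/PZ/PD.
pose lam := rnorm (T (a *: (k x1 + k x2))) ^+ 2.
have Ple x y : P x y -> normsq y <= lam * normsq x.
  move=> Pxy; rewrite -(PT _ _ Pxy); apply: op_norm_homogeneous.
    by rewrite nT.
  by move=> b; rewrite (PT _ _ Pxy); exact/PT/PZ.
have eq0 : normsq (a *: (h x1 + h x2)) = lam * normsq (a *: (k x1 + k x2)).
  rewrite -(rnorm_sqr (a *: (k x1 + k x2))) n1 /lam (PT _ _ P0) rnorm_sqr.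
  by rewrite expr1n mulr1.
have a0 : a != 0.
  apply: contra_eq_neq n1 => ->; rewrite scale0r /rnorm normr0 /=.
  by rewrite eq_sym oner_eq0.
exists lam => [|z].
  have k0 : 0 < normsq (h 0).
    rewrite lt_def normsq_ge0 andbT -(inj_eq (@complexI R)) -dot_normsq.
    by rewrite dot_fker cexp_neq0.
  rewrite ltNge; apply/negP => lam0.
  have := Ple _ _ (Pkh 0); rewrite leNgt => /negP; apply.
  by apply: le_lt_trans k0; rewrite mulr_le0_ge0// normsq_ge0.
have := maximizer_polar PD PZ Ple P0 eq0 (Pkh z).
rewrite !dotZl !dotDl mulrCA => /(mulfI a0).
by rewrite !dot_fker.
Qed.

End NormAttaining.

Lemma sum_delta (F : nzRingType) (I : eqType) (s : seq I) (b : F) (i : I)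
    (f : I -> F) :
  uniq s -> i \in s -> \sum_(j <- s) b * (j == i)%:R * f j = b * f i.
Proof.
move=> us ins; rewrite (bigD1_seq i)//= eqxx mulr1 big1 ?addr0// => j /negPf ->.
by rewrite mulr0 mul0r.
Qed.

(** By freeness, the total coefficient of each exponent is zero.  At [x1] and at
    [x2], distinct points, it is [- lam] plus those [c_i] with [u_i] equal to
    that point, so each of the two points must be some [u_i]. *)
Lemma two_exp_match (R : realType) (E : hilbertSpace R) (u1 u2 x1 x2 : E)
    (c1 c2 lam : R[i]) :
  lam != 0 -> x1 != x2 ->
  (forall z : E, c1 * cexp '[z, u1] + c2 * cexp '[z, u2] =
    lam * (cexp '[z, x1] + cexp '[z, x2])) ->
  [/\ c1 = lam, c2 = lam & (u1 = x1 /\ u2 = x2) \/ (u1 = x2 /\ u2 = x1)].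
Proof.
move=> lam0 x12 eqc.
pose c (u : E) := c1 * (u == u1)%:R + c2 * (u == u2)%:R
  - lam * (u == x1)%:R - lam * (u == x2)%:R.
pose s := undup [:: u1; u2; x1; x2].
have us : uniq s := undup_uniq _.
have cs w : w \in s -> c w = 0.
  apply: (exp_free us) => z.
  have sd b a : a \in [:: u1; u2; x1; x2] ->
      \sum_(u <- s) b * (u == a)%:R * cexp '[z, u] = b * cexp '[z, a].
    by move=> ain; apply: sum_delta => //; rewrite /s mem_undup.
  rewrite /c; under eq_bigr => j _ do rewrite !mulrBl mulrDl.
  rewrite !sumrB big_split /= !sd ?inE ?eqxx ?orbT// eqc.
  by ring.
have := cs x1; have := cs x2; rewrite /s !mem_undup !inE !eqxx !orbT /c.
rewrite eqxx (eq_sym x2 x1) (negPf x12) => /(_ isT) + /(_ isT).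
rewrite eqxx !mulr0 mulr1 !subr0.
(* Of the sixteen cases only the two matchings survive: an unmatched [x_i]
   forces [lam = 0], and a [u_i] matched twice forces [x1 = x2]. *)
have [e1|n1] := eqVneq x1 u1; have [e2|n2] := eqVneq x2 u2;
  have [e3|n3] := eqVneq x1 u2; have [e4|n4] := eqVneq x2 u1;
  rewrite ?mulr1 ?mulr0 ?addr0 ?add0r => h2 h1.
all: try by move: lam0; rewrite -oppr_eq0 ?h1 ?h2 eqxx.
all: try by move: x12; rewrite e1 e4 eqxx.
all: try by move: x12; rewrite e3 e2 eqxx.
all: move: (subr0_eq h1) (subr0_eq h2) => -> ->; split=> //; by [left|right].
Qed.

Theorem proposition4p2 (R : realType) (E : hilbertSpace R)
    (H : segalBargmann E) (phi : E -> E) (x1 x2 : E)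
    (hphi : propertyP phi) (hx1 : `|x1| = 1) (hx2 : `|x2| = 1)
    (hnorm : attains_norm_at (adjoint (comp_op (H := H) phi))
               (`|fker H x1 + fker H x2|^-1 *: (fker H x1 + fker H x2))) :
  `|phi x1| = `|phi x2|.
Proof.
have [->//|x12] := eqVneq x1 x2.
have [lam lam0 eqlam] := maximizer_kernel_eq hphi hnorm.
have [A [_ [b [_ [phiE AP _ _]]]]] := propertyP_split hphi.
pose u x := adjoint A (phi x); pose w x := '[b, phi x].
have lamN0 : lam%:C != 0 by rewrite (inj_eq (@complexI R)) gt_eqF.
have [z|c1 c2 ux] := @two_exp_match R E (u x1) (u x2) x1 x2
    (cexp (w x1)) (cexp (w x2)) lam%:C lamN0 x12.
  rewrite -eqlam -!cexpD; congr (cexp _ + cexp _);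
  by rewrite (phiE z) dotDl AP addrC.
have Rew : complex.Re (w x1) = complex.Re (w x2).
  by apply: Re_cexp_inj; rewrite c1 c2.
have phi2 x : normsq (phi x) = complex.Re '[x, u x] + complex.Re (w x).
  by rewrite /normsq {1}phiE dotDl ReD AP.
have eqn : normsq (phi x1) = normsq (phi x2).
  rewrite !phi2 Rew; congr (_ + _).
  case: ux => -[-> ->]; last by rewrite dotC ReC.
  by rewrite -!hdot_norm hx1 hx2.
by apply/eqP; rewrite -(@eqrXn2 _ 2)// !norm_normsq eqn.
Qed.
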